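(* Let $\Gamma$ be a countable set. For finite subsets $X\subset\Lambda$ of $\Gamma$, the map $\mathbb{E}^\Lambda_X:\mathcal{A}_\Lambda\to\mathcal{A}_\Lambda$ defined by $$\mathbb{E}_X^\Lambda(A)=\frac{1}{4^{|\Lambda\setminus X|}}\sum_{\alpha\in I_{\Lambda\setminus X}}u(\alpha)^*A\,u(\alpha)$$ satisfies: (i) $\|\mathbb{E}^\Lambda_X\|=1$; (ii) $(\mathbb{E}^\Lambda_X)^2=\mathbb{E}^\Lambda_X$; (iii) $\mathbb{E}^\Lambda_X(\mathcal{A}_\Lambda)=\mathcal{A}_X^\Lambda$, where $\mathcal{A}_X^\Lambda=\{A+B\theta_\Lambda: A\in\mathcal{A}_X^+,\ B\in\mathcal{A}_X^-\}$; (iv) $\mathbb{E}^\Lambda_X(\mathcal{A}_\Lambda^+)=\mathcal{A}_X^+$.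
   Context: For finite $\Lambda\subset\Gamma$, $\mathcal{A}_\Lambda$ is the CAR algebra generated by $a_x,a_x^*$, $x\in\Lambda$, with $\{a_x,a_y\}=\{a_x^*,a_y^*\}=0$, $\{a_x,a_y^*\}=\delta_{x,y}\mathbb{1}$, where $\{A,B\}=AB+BA$; for $X\subset\Lambda$, $\mathcal{A}_X\subset\mathcal{A}_\Lambda$ is the subalgebra generated by $a_x,a_x^*$, $x\in X$. Let $N_X=\sum_{x\in X}a_x^*a_x$ and $\theta_X=(-1)^{N_X}$. $\mathcal{A}_X^+$ and $\mathcal{A}_X^-$ are the sets of $A\in\mathcal{A}_X$ with $\theta_XA\theta_X=A$ and $\theta_XA\theta_X=-A$, respectively. For each site $x$ let $u_x^{(0)}=\mathbb{1}$, $u_x^{(1)}=a_x^*+a_x$, $u_x^{(2)}=a_x^*-a_x$, $u_x^{(3)}=\mathbb{1}-2a_x^*a_x$. Let $I_{\Lambda\setminus X}=\{0,1,2,3\}^{\Lambda\setminus X}$, fix an ordering $\Lambda\setminus X=\{x_1,\dots,x_n\}$, and for $\alpha\in I_{\Lambda\setminus X}$ let $u(\alpha)=u_{x_1}^{(\alpha(x_1))}\cdots u_{x_n}^{(\alpha(x_n))}\in\mathcal{A}_{\Lambda\setminus X}$. (The map $\mathbb{E}^\Lambda_X$ does not depend on the chosen ordering.) $\|\mathbb{E}_X^\Lambda\|$ is the operator norm of $\mathbb{E}^\Lambda_X$ with respect to the $C^*$-norm on $\mathcal{A}_\Lambda$. *)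

(* Defs.v *)
From HB Require Import structures.
From mathcomp Require Import all_boot all_order all_algebra finmap.
From mathcomp Require Import all_classical all_reals all_analysis.
From mathcomp Require Import complex.

Set Implicit Arguments.
Unset Strict Implicit.
Unset Printing Implicit Defensive.

Import Order.TTheory GRing.Theory Num.Theory.
Import numFieldNormedType.Exports.

Local Open Scope classical_set_scope.
Local Open Scope complex_scope.
Local Open Scope ring_scope.

(* Unital C*-algebras.  The norm is a field of its own, with values in [R],
   because the hierarchy has no join of [algType] and normed modules.
   [algType] is based on rings in which [1 != 0]. *)
HB.mixin Record Algebra_isCStar (R : realType) A & GRing.Algebra R[i] A := {
  star : A -> A ;
  cnorm : A -> R ;
  starK : involutive star ;
  starD : forall x y : A, star (x + y) = star x + star y ;
  starZ : forall (c : R[i]) (x : A), star (c *: x) = c^*%C *: star x ;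
  starM : forall x y : A, star (x * y) = star y * star x ;
  cnorm_ge0 : forall x : A, 0 <= cnorm x ;
  cnorm0_eq0 : forall x : A, cnorm x = 0 -> x = 0 ;
  cnormZ : forall (c : R[i]) (x : A), cnorm (c *: x) = Normc.normc c * cnorm x ;
  ler_cnormD : forall x y : A, cnorm (x + y) <= cnorm x + cnorm y ;
  ler_cnormM : forall x y : A, cnorm (x * y) <= cnorm x * cnorm y ;
  cnorm_starM : forall x : A, cnorm (star x * x) = cnorm x ^+ 2 ;
  cnorm_complete : forall s : nat -> A,
    (forall e : R, 0 < e -> exists N : nat, forall m n : nat,
       (N <= m)%N -> (N <= n)%N -> cnorm (s m - s n) < e) ->
    exists l : A, cnorm (s n - l) @[n --> \oo] --> (0 : R)
}.

#[short(type="cstarAlgType")]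
HB.structure Definition CStarAlgebra (R : realType) :=
  {A of GRing.Algebra R[i] A & Algebra_isCStar R A}.

(* Extended-real valued, so that unbounded maps have norm [+oo]. *)
Definition opnorm (R : realType) (A : cstarAlgType R) (f : A -> A) : \bar R :=
  ereal_sup [set (cnorm (f x))%:E | x in [set x : A | cnorm x <= 1]].

(* The sum of the exponential series in the norm of [A]. *)
Definition cexp (R : realType) (A : cstarAlgType R) (x : A) : A :=
  xget 0 [set y : A |
    cnorm (\sum_(0 <= k < n) (k`!%:R : R[i])^-1 *: x ^+ k - y) @[n --> \oo]
      --> (0 : R)].

(* (-1)^N = exp (i pi N) *)
Definition sign_pow (R : realType) (A : cstarAlgType R) (N : A) : A :=
  cexp ((0 +i* pi)%C *: N).

Definition gen_subalg (R : realType) (A : cstarAlgType R) (G : set A) : set A :=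
  smallest (fun S : set A => GRing.subalg_closed (mem S)) G.

(* Sites of a finite [L] are elements of the finite type attached to [L];
   subsets [X] of [L] remain finite subsets of [Gamma]. *)
Definition local_alg (R : realType) (Gamma : countType) (L : {fset Gamma})
    (A : cstarAlgType R) (a : L -> A) (X : {fset Gamma}) : set A :=
  gen_subalg [set z : A | exists2 x : L, val x \in X & z = a x \/ z = star (a x)].

Definition anticomm (R : nzRingType) (x y : R) : R := x * y + y * x.

(* [A] is the CAR algebra over [L], with annihilation operators [a].
   Since [L] is finite, no closure is needed in [car_gen]. *)
Record is_CAR_algebra (R : realType) (Gamma : countType) (L : {fset Gamma})
    (A : cstarAlgType R) (a : L -> A) : Prop := {
  car_aa : forall x y : L, anticomm (a x) (a y) = 0 ;
  car_ss : forall x y : L, anticomm (star (a x)) (star (a y)) = 0 ;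
  car_as : forall x y : L, anticomm (a x) (star (a y)) = (x == y)%:R ;
  car_gen : local_alg a L = setT
}.

Definition number_op (R : realType) (Gamma : countType) (L : {fset Gamma})
    (A : cstarAlgType R) (a : L -> A) (X : {fset Gamma}) : A :=
  \sum_(x : L | val x \in X) star (a x) * a x.

Definition theta (R : realType) (Gamma : countType) (L : {fset Gamma})
    (A : cstarAlgType R) (a : L -> A) (X : {fset Gamma}) : A :=
  sign_pow (number_op a X).

Definition even_alg (R : realType) (Gamma : countType) (L : {fset Gamma})
    (A : cstarAlgType R) (a : L -> A) (X : {fset Gamma}) : set A :=
  [set z : A | local_alg a X z /\ theta a X * z * theta a X = z].

Definition odd_alg (R : realType) (Gamma : countType) (L : {fset Gamma})
    (A : cstarAlgType R) (a : L -> A) (X : {fset Gamma}) : set A :=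
  [set z : A | local_alg a X z /\ theta a X * z * theta a X = - z].

Definition u_site (R : realType) (Gamma : countType) (L : {fset Gamma})
    (A : cstarAlgType R) (a : L -> A) (x : L) (k : 'I_4) : A :=
  nth 0 [:: 1; star (a x) + a x; star (a x) - a x; 1 - (star (a x) * a x) *+ 2] k.

(* [s] lists the sites of L \ X in the order of the factors. *)
Definition u_prod (R : realType) (Gamma : countType) (L X : {fset Gamma})
    (A : cstarAlgType R) (a : L -> A) (s : seq (L `\` X)%fset)
    (alpha : {ffun (L `\` X)%fset -> 'I_4}) : A :=
  \prod_(x <- s) u_site a (fincl (fsubsetDl L X) x) (alpha x).

Definition cond_exp (R : realType) (Gamma : countType) (L X : {fset Gamma})
    (A : cstarAlgType R) (a : L -> A) (s : seq (L `\` X)%fset) (z : A) : A :=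
  ((4 : R[i]) ^+ #|` (L `\` X)%fset|)^-1 *:
    \sum_(alpha : {ffun (L `\` X)%fset -> 'I_4})
       star (u_prod a s alpha) * z * u_prod a s alpha.

(* Main.v *)
(* Write gamma for the Majorana operators a_x^* + a_x and a_x^* - a_x.  They
   anticommute pairwise and square to +1 or -1, so that A_Lambda is spanned by
   words in them, and up to sign a word depends only on the parities of the
   multiplicities of its letters; up to sign u(alpha) runs over all square-free
   words in the letters outside X.  Multiplication by an outer gamma permutes
   the u(alpha) up to sign; hence E(z) commutes with the outer gammas, E(z) = z
   if z does, and E(z) = 0 if z anticommutes with one of them.  A word commuting
   with all outer gammas either has even length and each outer letter an even
   number of times, and is then, up to sign, an even word in the letters of X;
   or it has odd length and each outer letter an odd number of times, and is
   then an odd word in the letters of X times theta_Lambda. *)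

Require Import Defs.
From HB Require Import structures.
From mathcomp Require Import all_boot all_order all_algebra finmap.
From mathcomp Require Import all_classical all_reals all_analysis.
From mathcomp Require Import complex ring.

Set Implicit Arguments.
Unset Strict Implicit.
Unset Printing Implicit Defensive.

Import Order.TTheory GRing.Theory Num.Theory.
Import numFieldNormedType.Exports.

Local Open Scope classical_set_scope.
Local Open Scope ring_scope.

(** * C*-algebras and the exponential *)

Section CStar.
Variables (R : realType) (A : cstarAlgType R).
Implicit Types (x y z : A) (c : R[i]).

Lemma starN x : star (- x) = - star x.
Proof. by rewrite -scaleN1r starZ rmorphN1 scaleN1r. Qed.

Lemma starB x y : star (x - y) = star x - star y.
Proof. by rewrite starD starN. Qed.

Lemma star0 : star (0 : A) = 0.
Proof. by rewrite -(subrr (0 : A)) starB !subrr. Qed.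

Lemma star1 : star (1 : A) = 1.
Proof. by rewrite -[LHS]mulr1 -{2}(starK (1 : A)) -starM mulr1 starK. Qed.

Lemma cnorm0 : cnorm (0 : A) = 0.
Proof. by rewrite -(scale0r (0 : A)) cnormZ Normc.normc0 mul0r. Qed.

Lemma cnormN x : cnorm (- x) = cnorm x.
Proof. by rewrite -scaleN1r cnormZ normcN Normc.normc1 mul1r. Qed.

(** The C*-identity and submultiplicativity give [cnorm y ^+ 2 <= cnorm (star y) * cnorm y];
    cancelling one factor gives one inequality, and the involution gives the other. *)
Lemma cnorm_star x : cnorm (star x) = cnorm x.
Proof.
suff le_star y : cnorm y <= cnorm (star y).
  by apply/eqP; rewrite eq_le le_star -{2}(starK x) le_star.
have [->//|y0] := eqVneq (cnorm y) 0; first exact: cnorm_ge0.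
have ygt0 : 0 < cnorm y by rewrite lt_def y0 cnorm_ge0.
by rewrite -(ler_pM2r ygt0) -expr2 -cnorm_starM ler_cnormM.
Qed.

Lemma cnorm_unitary (u : A) : star u * u = 1 -> cnorm u = 1 :> R.
Proof.
(* The norm of [1] is an idempotent real; the value 0 is excluded because [1 != 0] in [A]. *)
have n1 : cnorm (1 : A) = 1.
  have : cnorm (1 : A) * (cnorm (1 : A) - 1) = 0.
    by rewrite mulrBr mulr1 -expr2 -cnorm_starM star1 mulr1 subrr.
  move/eqP; rewrite mulf_eq0 subr_eq0 => /orP[/eqP/cnorm0_eq0/eqP|/eqP//].
  by rewrite oner_eq0.
move=> uu; have /eqP := cnorm_starM u; rewrite uu n1 eq_sym sqrf_eq1.
move=> /orP[/eqP//|/eqP n0].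
by have := cnorm_ge0 u; rewrite n0 oppr_ge0 ler10.
Qed.

Lemma ler_cnorm_sum (I : Type) (r : seq I) (P : pred I) (F : I -> A) :
  cnorm (\sum_(i <- r | P i) F i) <= \sum_(i <- r | P i) cnorm (F i).
Proof.
elim/big_rec2: _ => [|i n x _ le_xn]; first by rewrite cnorm0.
by rewrite (le_trans (ler_cnormD _ _)) // lerD2l.
Qed.


Lemma cvgD0 (f g : nat -> R) :
  f n @[n --> \oo] --> (0 : R) -> g n @[n --> \oo] --> (0 : R) ->
  f n + g n @[n --> \oo] --> (0 : R).
Proof. by move=> f0 g0; rewrite -(addr0 0); exact: cvgD. Qed.

Lemma cnorm_cvg_unique (s : nat -> A) x y :
  cnorm (s n - x) @[n --> \oo] --> (0 : R) ->
  cnorm (s n - y) @[n --> \oo] --> (0 : R) -> x = y.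
Proof.
move=> sx sy; apply/subr0_eq/cnorm0_eq0; apply/eqP.
rewrite eq_le cnorm_ge0 andbT.
apply: (cvgr_to_ge (cvgD0 sx sy)); near=> n.
by rewrite -(cnormN (s n - x)) (le_trans _ (ler_cnormD _ _)) // opprB addrA subrK.
Unshelve. all: by end_near. Qed.

Lemma cnorm_cvgD (s t : nat -> A) x y :
  cnorm (s n - x) @[n --> \oo] --> (0 : R) ->
  cnorm (t n - y) @[n --> \oo] --> (0 : R) ->
  cnorm (s n + t n - (x + y)) @[n --> \oo] --> (0 : R).
Proof.
move=> sx ty; apply: (squeeze_cvgr _ (cvg_cst _) (cvgD0 sx ty)); near=> n.
by rewrite cnorm_ge0 opprD addrACA ler_cnormD.
Unshelve. all: by end_near. Qed.

(** Norm limits are unique, so exhibiting one limit determines the value chosen by [xget], and its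
    default 0 does not arise. *)
Lemma cexp_unique x y :
  cnorm (\sum_(0 <= k < n) (k`!%:R : R[i])^-1 *: x ^+ k - y) @[n --> \oo]
    --> (0 : R) -> cexp x = y.
Proof.
move=> xy; rewrite /cexp; case: xgetP => [z _ xz|/(_ _ xy)//].
exact: cnorm_cvg_unique xz xy.
Qed.

Lemma normc_le_add (u v : R) : Normc.normc (u +i* v)%C <= `|u| + `|v|.
Proof.
have split_uv : (u +i* v = u +i* 0 + 0 +i* v)%C by simpc.
rewrite split_uv (le_trans (le_normcD _ _)) // /Normc.normc /=.
by rewrite expr0n /= addr0 add0r !sqrtr_sqr.
Qed.

(** Even powers of i are real and odd ones imaginary, so the exponential series at an imaginary
    argument splits termwise into the cosine and sine series. *)
Lemma exp_coeff_imag (x : R) k :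
  (k`!%:R : R[i])^-1 * (0 +i* x)%C ^+ k = (cos_coeff x k +i* sin_coeff x k)%C.
Proof.
have -> : (0 +i* x)%C = 'i%C * (x%:C)%C by simpc.
have -> : (k`!%:R : R[i])^-1 = (((k`!%:R)^-1 : R)%:C)%C.
  by rewrite fmorphV rmorph_nat.
rewrite exprMn -rmorphXn /cos_coeff /sin_coeff /= -exprnP.
rewrite -[in 'i%C ^+ _](odd_double_half k).
have i2 m : 'i%C ^+ m.*2 = (((-1) ^+ m : R)%:C)%C.
  by rewrite -mul2n exprM sqr_i rmorphXn rmorphN1.
case: (boolP (odd k)) => [k_odd|_].
  have -> : k.-1./2 = k./2 by rewrite -[k in k.-1]odd_double_half k_odd /= doubleK.
  by rewrite add1n exprS i2; simpc; congr (_ +i* _)%C; rewrite ?mul0r //; ring.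
by rewrite add0n i2; simpc; congr (_ +i* _)%C; rewrite ?mul0r //; ring.
Qed.

Lemma cos_natMpi k : cos (pi *+ k : R) = (-1) ^+ k.
Proof. by rewrite -[pi *+ k]add0r (alternatingn (@cosDpi R)) cos0 mulr1. Qed.

Lemma sin_natMpi k : sin (pi *+ k : R) = 0.
Proof. by rewrite -[pi *+ k]add0r (alternatingn (@sinDpi R)) sin0 mulr0. Qed.

(** On an eigenvector of eigenvalue [k] the operator series acts as the scalar series of exp(i pi
    k), whose real and imaginary parts tend to cos(k pi) = (-1)^k and sin(k pi) = 0. *)
Lemma exp_eigenvector x z k : x * z = z *+ k ->
  cnorm ((\sum_(0 <= j < n) (j`!%:R : R[i])^-1 *: ((0 +i* pi)%C *: x) ^+ j) * z
         - (-1) ^+ k * z) @[n --> \oo] --> (0 : R).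
Proof.
move=> xz; set p : R := pi *+ k.
have powE j : ((0 +i* pi)%C *: x) ^+ j * z = (0 +i* p)%C ^+ j *: z.
  elim: j => [|j IHj]; first by rewrite !expr0 mul1r scale1r.
  rewrite exprSr -mulrA -scalerAl xz -scalerMnr mulrnAr -scalerAr IHj.
  rewrite scalerMnl scalerA exprS; congr (_ *: _).
  by congr (_ * _); rewrite /p; elim: (k) => [|i IHi];
     rewrite ?mulr0n // !mulrS IHi; simpc.
have sumE n :
    (\sum_(0 <= j < n) (j`!%:R : R[i])^-1 *: ((0 +i* pi)%C *: x) ^+ j) * z =
    (series (cos_coeff p) n +i* series (sin_coeff p) n)%C *: z.
  rewrite mulr_suml /series /=; elim: n => [|n IHn].
    by rewrite !big_geq // scale0r.
  rewrite !big_nat_recr //= IHn -scalerAl powE scalerA exp_coeff_imag -scalerDl.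
  by congr (_ *: _); simpc.
have signE : (-1) ^+ k * z = ((-1) ^+ k +i* 0)%C *: z.
  rewrite -[((-1) ^+ k +i* 0)%C]/((((-1) ^+ k : R)%:C)%C) rmorphXn rmorphN1.
  rewrite -[in LHS]signr_odd -[in RHS]signr_odd.
  by case: odd; rewrite ?expr1 ?expr0 ?mulN1r ?scaleN1r ?mul1r ?scale1r.
have cos_cvg : series (cos_coeff p) n - (-1) ^+ k @[n --> \oo] --> (0 : R).
  by apply/subr_cvg0; rewrite -cos_natMpi unlock; exact: is_cvg_series_cos_coeff.
have sin_cvg : series (sin_coeff p) n @[n --> \oo] --> (0 : R).
  by rewrite -(sin_natMpi k) unlock; exact: is_cvg_series_sin_coeff.
have norm_cvg (f : nat -> R) :
    f n @[n --> \oo] --> (0 : R) -> `|f n| @[n --> \oo] --> (0 : R).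
  by move=> /cvg_norm; rewrite normr0.
have bound_cvg : (`|series (cos_coeff p) n - (-1) ^+ k| + `|series (sin_coeff p) n|)
    * cnorm z @[n --> \oo] --> (0 : R).
  rewrite -[0](mul0r (cnorm z)); apply: cvgMl.
  by apply: cvgD0; exact: norm_cvg.
apply: (squeeze_cvgr _ (cvg_cst _) bound_cvg); near=> n.
rewrite cnorm_ge0 sumE signE -scalerBl cnormZ ler_wpM2r ?cnorm_ge0 //=.
by rewrite (le_trans _ (normc_le_add _ _)) //; simpc.
Unshelve. all: by end_near. Qed.

(* Splitting [z = p i * z + (1 - p i) * z] for each [i] in turn reduces to
   common eigenvectors, where [exp_eigenvector] applies. *)
Lemma cexp_sum_idempotents (I : Type) (p : I -> A) (r : seq I) :
  (forall i, p i * p i = p i) -> (forall i j, GRing.comm (p i) (p j)) ->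
  cexp ((0 +i* pi)%C *: \sum_(i <- r) p i) = \prod_(i <- r) (1 - p i *+ 2).
Proof.
move=> pp pC; pose E x n : A :=
  \sum_(0 <= j < n) (j`!%:R : R[i])^-1 *: ((0 +i* pi)%C *: x) ^+ j.
(* Generalized for induction on [r]: [x] collects the idempotents already treated and [k] is its
   eigenvalue on [z]. The claim is the case [x = 0], [z = 1], [k = 0]. *)
suff eigen_cvg x z k : x * z = z *+ k -> (forall i, GRing.comm x (p i)) ->
    cnorm (E (x + \sum_(i <- r) p i) n * z
      - (-1) ^+ k * (\prod_(i <- r) (1 - p i *+ 2) * z)) @[n --> \oo] --> (0 : R).
  apply: cexp_unique.
  have := eigen_cvg 0 1 0; rewrite mul0r => /(_ erefl (fun i => commr_sym (commr0 _))).
  by under eq_fun do rewrite add0r !mulr1 expr0 mul1r.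
elim: r x z k => [|i r IHr] x z k xz xp.
  by under eq_fun do rewrite !big_nil addr0 mul1r; exact: exp_eigenvector.
have xpC j : GRing.comm (x + p i) (p j).
  by apply: commr_sym; apply: commrD; [exact: commr_sym | exact: pC].
(* Adding [p i] to [x] raises the eigenvalue by one on [p i * z] and leaves it unchanged on the
   complementary part. *)
have occupied := IHr (x + p i) (p i * z) k.+1 _ xpC.
have empty := IHr (x + p i) ((1 - p i) * z) k _ xpC.
have /occupied{}occupied : (x + p i) * (p i * z) = (p i * z) *+ k.+1.
  by rewrite mulrA mulrDl xp pp mulrDl -mulrA xz mulrnAr mulrSr.
have /empty{}empty : (x + p i) * ((1 - p i) * z) = ((1 - p i) * z) *+ k.
  have -> : (x + p i) * ((1 - p i) * z) = (1 - p i) * (x * z).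
    rewrite !mulrA; congr (_ * z).
    by rewrite mulrDl !mulrBr !mulr1 pp subrr addr0 mulrBl mul1r xp.
  by rewrite xz mulrnAr.
have prodC : GRing.comm (1 - p i *+ 2) (\prod_(j <- r) (1 - p j *+ 2)).
  apply: commr_prod => j _; apply: commrB; first exact: commr1.
  apply: commrMn; apply: commr_sym; apply: commrB; first exact: commr1.
  exact: commrMn.
have splitE n : E (x + \sum_(j <- i :: r) p j) n * z
      - (-1) ^+ k * (\prod_(j <- i :: r) (1 - p j *+ 2) * z) =
    E (x + p i + \sum_(j <- r) p j) n * (p i * z) +
    E (x + p i + \sum_(j <- r) p j) n * ((1 - p i) * z) -
    ((-1) ^+ k.+1 * (\prod_(j <- r) (1 - p j *+ 2) * (p i * z)) +
     (-1) ^+ k * (\prod_(j <- r) (1 - p j *+ 2) * ((1 - p i) * z))).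
  rewrite !big_cons addrA; congr (_ - _).
    by rewrite -mulrDr -mulrDl [p i + _]addrC subrK mul1r.
  (* The extra sign on the occupied part recombines the two pieces: (1 - p) - p = 1 - 2p. *)
  rewrite exprS mulN1r mulNr [RHS]addrC -mulrBr -mulrBr; congr (_ * _).
  by rewrite -mulrBl prodC -mulrA mulr2n opprD addrA.
by under eq_fun do rewrite splitE; exact: cnorm_cvgD.
Qed.

End CStar.

(** * Generated subalgebras *)

Section GeneratedSubalgebra.
Variables (R : realType) (A : cstarAlgType R) (G : set A).

Lemma gen_subalg_ind (S : set A) :
  S 1 -> (forall (c : R[i]) x y, S x -> S y -> S (c *: x + y)) ->
  (forall x y, S x -> S y -> S (x * y)) -> G `<=` S -> gen_subalg G `<=` S.
Proof.
move=> S1 SD SM GS; apply: smallest_sub => //; split=> [|c x y|x y].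
- by rewrite in_setE.
- by rewrite !in_setE; exact: SD.
- by rewrite !in_setE; exact: SM.
Qed.

Lemma gen_subalg_gen : G `<=` gen_subalg G.
Proof. exact: sub_gen_smallest. Qed.

Lemma gen_subalg1 : gen_subalg G 1.
Proof. by move=> S [[]]; rewrite in_setE. Qed.

Lemma gen_subalg_linear (c : R[i]) x y :
  gen_subalg G x -> gen_subalg G y -> gen_subalg G (c *: x + y).
Proof.
move=> Gx Gy S SG; have [[_ + _] _] := SG; move=> /(_ c x y).
by rewrite !in_setE; apply; [exact: Gx | exact: Gy].
Qed.

Lemma gen_subalgM x y : gen_subalg G x -> gen_subalg G y -> gen_subalg G (x * y).
Proof.
move=> Gx Gy S SG; have [[_ _ +] _] := SG; move=> /(_ x y).
by rewrite !in_setE; apply; [exact: Gx | exact: Gy].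
Qed.

Lemma gen_subalgZ (c : R[i]) x : gen_subalg G x -> gen_subalg G (c *: x).
Proof.
move=> Gx; rewrite -[c *: x]addr0; apply: gen_subalg_linear => //.
rewrite -(subrr 1) addrC -scaleN1r.
by apply: gen_subalg_linear; exact: gen_subalg1.
Qed.

Lemma gen_subalg_sign (b : bool) x : gen_subalg G x -> gen_subalg G ((-1) ^+ b * x).
Proof.
by case: b => Gx; rewrite ?expr0 ?mul1r // expr1 mulN1r -scaleN1r; exact: gen_subalgZ.
Qed.

End GeneratedSubalgebra.

(** * Words in anticommuting letters *)

Section SignEquality.
Variable A : pzRingType.
Implicit Types x y z : A.

Definition eq_sign x y := exists e : bool, x = (-1) ^+ e * y.

Lemma eq_sign_refl x : eq_sign x x.
Proof. by exists false; rewrite expr0 mul1r. Qed.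

Lemma eq_sign_sym x y : eq_sign x y -> eq_sign y x.
Proof. by case=> e ->; exists e; rewrite signrMK. Qed.

Lemma eq_sign_trans y x z : eq_sign x y -> eq_sign y z -> eq_sign x z.
Proof. by case=> e -> [f ->]; exists (e (+) f); rewrite signr_addb mulrA. Qed.

Lemma eq_signM x y z t : eq_sign x y -> eq_sign z t -> eq_sign (x * z) (y * t).
Proof.
case=> e -> [f ->]; exists (e (+) f).
by rewrite signr_addb -!mulrA; congr (_ * _); rewrite !mulrA commr_sign.
Qed.

Lemma eq_signN x y : x = - y -> eq_sign x y.
Proof. by move=> ->; exists true; rewrite mulN1r. Qed.

End SignEquality.

Section Words.
Variables (A : pzRingType) (G : finType) (gam : G -> A).
Hypothesis gam_anticomm :
  forall g h, g != h -> gam g * gam h = - (gam h * gam g).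
Hypothesis gam_sqr : forall g, eq_sign (gam g * gam g) 1.
Implicit Types (g h : G) (w v : seq G).

(** The letters are abstract because two alphabets occur below: all Majorana operators, and those
    outside [X] only. *)
Definition word w : A := \prod_(g <- w) gam g.

Lemma word_cat w v : word (w ++ v) = word w * word v.
Proof. exact: big_cat. Qed.

Lemma word_cons g w : word (g :: w) = gam g * word w.
Proof. exact: big_cons. Qed.

(** Each letter of [w] other than [g] contributes one sign; [size w + count_mem g w] has the parity
    of the number of such letters. *)
Lemma gam_word g w :
  gam g * word w = (-1) ^+ (size w + count_mem g w) * (word w * gam g).
Proof.
elim: w => [|h w IHw]; first by rewrite /word big_nil !mul1r mulr1.
rewrite word_cons /=; have [->|ne_hg] := eqVneq h g.
  rewrite [in LHS]IHw addSn addnA addn1 !exprS !mulN1r opprK.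
  by rewrite mulrA commr_sign -!mulrA.
rewrite mulrA gam_anticomm 1?eq_sym // add0n addSn exprS mulN1r !mulNr.
by congr (- _); rewrite -mulrA IHw [LHS]mulrA commr_sign -!mulrA.
Qed.

Lemma gam_word_sign g w : eq_sign (gam g * word w) (word w * gam g).
Proof. by rewrite gam_word -signr_odd; eexists. Qed.

(** Left multiplication by [g] toggles [g] in a square-free word: [g] moves, up to sign, to its
    unique place in [e], where it is either inserted or cancelled by its square. *)
Lemma word_gam_filter (e : seq G) (b : pred G) g : uniq e -> g \in e ->
  eq_sign (gam g * word [seq h <- e | b h])
          (word [seq h <- e | b h (+) (h == g)]).
Proof.
elim: e => [//|h e IHe] /= /andP[h_e e_uniq]; rewrite inE.
have [-> _|ne_gh /= g_e] := eqVneq g h.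
  rewrite addbT; have -> : [seq k <- e | b k (+) (k == h)] = [seq k <- e | b k].
    apply: eq_in_filter => k k_e; case: eqP => [k_g|]; rewrite ?addbF //.
    by rewrite -k_g k_e in h_e.
  case: (b h) => /=; last by rewrite word_cons; exact: eq_sign_refl.
  rewrite word_cons mulrA -[X in eq_sign _ X]mul1r.
  exact: eq_signM (gam_sqr h) (eq_sign_refl _).
rewrite addbF; case: (b h) => /=; last exact: IHe.
rewrite !word_cons mulrA gam_anticomm // mulNr -mulrA.
apply: eq_sign_trans (eq_signN erefl) _.
exact: eq_signM (eq_sign_refl _) (IHe _ _).
Qed.

Lemma word_normal_form w :
  eq_sign (word w) (word [seq h <- enum G | odd (count_mem h w)]).
Proof.
elim: w => [|g w IHw].
  by rewrite (@eq_filter _ _ pred0) // filter_pred0; exact: eq_sign_refl.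
rewrite word_cons.
apply: eq_sign_trans (eq_signM (eq_sign_refl _) IHw) _.
apply: eq_sign_trans (word_gam_filter _ (enum_uniq _) _) _.
  by rewrite mem_enum.
rewrite (eq_filter (a2 := fun h => odd (count_mem h (g :: w)))).
  exact: eq_sign_refl.
by move=> h /=; rewrite oddD oddb addbC eq_sym.
Qed.

Lemma eq_sign_word w v :
  (forall g, odd (count_mem g w) = odd (count_mem g v)) ->
  eq_sign (word w) (word v).
Proof.
move=> wv; apply: eq_sign_trans (word_normal_form w) _.
by rewrite (eq_filter wv); exact/eq_sign_sym/word_normal_form.
Qed.

End Words.
(** * Majorana operators of a CAR algebra *)

Section CAR.
Variables (R : realType) (Gamma : countType) (L : {fset Gamma}).
Variables (A : cstarAlgType R) (a : L -> A).
Hypothesis hA : is_CAR_algebra a.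
Implicit Types (x y : L) (g h : L * bool) (X : {fset Gamma}) (z : A).

Lemma eq_oppr0 z : z = - z -> z = 0.
Proof.
move=> zN; have : (2 : R[i]) *: z = 0.
  by rewrite scaler_nat mulr2n {2}zN subrr.
by move/eqP; rewrite scaler_eq0 pnatr_eq0 /= => /eqP.
Qed.

Lemma car_sqr0 x : a x * a x = 0.
Proof.
apply: eq_oppr0; apply/eqP.
by rewrite -addr_eq0 -[_ + _]/(anticomm _ _) (car_aa hA).
Qed.

Lemma car_star_sqr0 x : star (a x) * star (a x) = 0.
Proof. by rewrite -starM car_sqr0 star0. Qed.

(** The letter [(x, false)] is u^(1) and [(x, true)] is u^(2). No factor i is included, so the
    latter is skew-adjoint with square -1. *)
Definition majorana g : A :=
  if g.2 then star (a g.1) - a g.1 else star (a g.1) + a g.1.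

Lemma anticommC (B : nzRingType) (u v : B) : anticomm u v = anticomm v u.
Proof. exact: addrC. Qed.

Lemma anticommDl (B : nzRingType) (u v w : B) :
  anticomm (u + v) w = anticomm u w + anticomm v w.
Proof. by rewrite /anticomm mulrDl mulrDr addrACA. Qed.

Lemma anticommNl (B : nzRingType) (u w : B) : anticomm (- u) w = - anticomm u w.
Proof. by rewrite /anticomm mulNr mulrN opprD. Qed.

Lemma majoranaE g : majorana g = star (a g.1) + (-1) ^+ g.2 * a g.1.
Proof. by rewrite /majorana; case: g.2; rewrite ?mulN1r ?mul1r. Qed.

(** Only the mixed brackets of a and a^* survive; on one site they add up for equal letters and
    cancel for different ones. *)
Lemma anticomm_majorana g h :
  anticomm (majorana g) (majorana h) =
  if g == h then (-1) ^+ g.2 *+ 2 else 0.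
Proof.
case: g h => [x b] [y c].
have signE (e : bool) z : (-1) ^+ e * z = if e then - z else z.
  by case: e; rewrite ?mulN1r ?mul1r.
rewrite !majoranaE /= !signE anticommDl ![anticomm _ (_ + _)]anticommC !anticommDl.
rewrite (car_ss hA) add0r.
rewrite -pair_eqE /= /pair_eq /=.
case: b c => [] [] /=; rewrite ?anticommNl ?[anticomm _ (- _)]anticommC ?anticommNl.
all: rewrite ?[anticomm (a y) (star _)]anticommC ?[anticomm (a y) (a x)]anticommC.
all: rewrite (anticommC (star (a x))) ?(anticommC (star (a y))).
all: rewrite (car_aa hA) !(car_as hA).
all: rewrite (eq_sym y) ?oppr0 ?addr0 -?opprD.
all: by case: eqVneq => _ /=;
  rewrite ?expr1 ?expr0 ?subrr ?addNr ?addr0 ?oppr0 ?mulNrn.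
Qed.

Lemma majorana_anticomm g h : g != h ->
  majorana g * majorana h = - (majorana h * majorana g).
Proof.
move=> gh; apply/eqP; rewrite -addr_eq0 -[_ + _]/(anticomm _ _).
by rewrite anticomm_majorana (negbTE gh).
Qed.

Lemma majorana_sqr g : majorana g * majorana g = (-1) ^+ g.2.
Proof.
have := anticomm_majorana g g; rewrite eqxx /anticomm -mulr2n => gg.
have /eqP : (2 : R[i]) *: (majorana g * majorana g - (-1) ^+ g.2) = 0.
  by rewrite scaler_nat mulrnBl gg subrr.
by rewrite scaler_eq0 pnatr_eq0 /= subr_eq0 => /eqP.
Qed.

Lemma majorana_sqr_sign g : eq_sign (majorana g * majorana g) 1.
Proof. by rewrite majorana_sqr; exists g.2; rewrite mulr1. Qed.

Lemma star_majorana g : star (majorana g) = (-1) ^+ g.2 * majorana g.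
Proof.
rewrite /majorana; case: g.2; rewrite ?starB ?starD starK.
  by rewrite expr1 mulN1r opprB.
by rewrite expr0 mul1r addrC.
Qed.

Lemma majorana_unitaryl g : star (majorana g) * majorana g = 1.
Proof. by rewrite star_majorana -mulrA majorana_sqr -expr2 sqrr_sign. Qed.

Lemma majorana_unitaryr g : majorana g * star (majorana g) = 1.
Proof.
by rewrite star_majorana mulrA commr_sign -mulrA majorana_sqr -expr2 sqrr_sign.
Qed.

Local Notation gword := (word majorana).

(** * Parity operators as words *)

Lemma parity_site x :
  1 - (star (a x) * a x) *+ 2 = majorana (x, false) * majorana (x, true).
Proof.
rewrite /majorana /= mulrDl !mulrBr car_sqr0 car_star_sqr0 sub0r subr0.
have := car_as hA x x; rewrite eqxx => /(canRL (addrK _)) ->.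
by rewrite [RHS]addrC mulr2n opprD addrA.
Qed.

Definition sites_word (r : seq L) := [seq (x, b) | x <- r, b <- [:: false; true]].

Lemma gword_sites r :
  gword (sites_word r) = \prod_(x <- r) (majorana (x, false) * majorana (x, true)).
Proof.
elim: r => [|x r IHr]; first by rewrite /word !big_nil.
by rewrite big_cons /= !word_cons IHr mulrA.
Qed.

Definition subset_word X := sites_word [seq x <- index_enum L | val x \in X].

Lemma count_subset_word X g : count_mem g (subset_word X) = (val g.1 \in X).
Proof.
rewrite count_uniq_mem; last first.
  apply: allpairs_uniq => //; first by rewrite filter_uniq // index_enum_uniq.
  by case=> ? ? [].
congr nat_of_bool; apply/allpairsP/idP => [[[x b]]|gX].
  by rewrite mem_filter /= => -[/andP[xX _] _ ->].
by exists g; rewrite mem_filter mem_index_enum gX; case: g {gX} => ? [].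
Qed.

Lemma size_sites_word r : odd (size (sites_word r)) = false.
Proof. by elim: r => //= x r ->. Qed.

(** Together with [number_comm], this makes [cexp_sum_idempotents] applicable to the number
    operator. *)
Lemma number_idem x : star (a x) * a x * (star (a x) * a x) = star (a x) * a x.
Proof.
have := car_as hA x x; rewrite eqxx => /(canRL (addrK _)).
rewrite -mulrA [a x * (_ * _)]mulrA => ->.
by rewrite mulrBl mul1r mulrBr !mulrA car_star_sqr0 !mul0r subr0.
Qed.

Lemma number_comm x y : GRing.comm (star (a x) * a x) (star (a y) * a y).
Proof.
have [-> //|ne_xy] := eqVneq x y.
have swap (u v : A) : anticomm u v = 0 -> u * v = - (v * u).
  by move=> uv; apply/eqP; rewrite -addr_eq0; apply/eqP.
have aa := swap _ _ (car_aa hA x y); have ss := swap _ _ (car_ss hA x y).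
have as_ : a x * star (a y) = - (star (a y) * a x).
  by apply: swap; rewrite (car_as hA) (negbTE ne_xy).
have sa : star (a x) * a y = - (a y * star (a x)).
  by apply: swap; rewrite anticommC (car_as hA) eq_sym (negbTE ne_xy).
apply: commrM; rewrite /GRing.comm.
  by rewrite -mulrA as_ mulrN [X in - X]mulrA ss mulNr opprK mulrA.
by rewrite -mulrA aa mulrN [X in - X]mulrA sa mulNr opprK mulrA.
Qed.

(** The exponential becomes a product of factors 1 - 2 a^* a, each a product of two Majorana
    operators. From here on, parity is a matter of counting signs in words. *)
Lemma theta_word X : theta a X = gword (subset_word X).
Proof.
rewrite /theta /sign_pow /number_op -big_filter.
rewrite (cexp_sum_idempotents _ number_idem number_comm) gword_sites.
by apply: eq_bigr => x _; exact: parity_site.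
Qed.

Lemma theta_sqr X : theta a X * theta a X = 1.
Proof.
rewrite theta_word gword_sites -prodrM_comm => [|x y _ _]; last first.
  rewrite -!parity_site; apply: commrB; first exact: commr1.
  apply: commrMn; apply: commr_sym; apply: commrB; first exact: commr1.
  exact/commrMn/number_comm.
(* At one site, exchanging the two inner letters gives a sign, which compensates the square -1 of
   the skew-adjoint letter. *)
apply: big1_seq => x _; rewrite -mulrA [majorana (x, true) * _]mulrA.
rewrite (majorana_anticomm (g := (x, true)) (h := (x, false))) ?xpair_eqE ?andbF //.
rewrite mulNr mulrN -mulrA majorana_sqr mulrA majorana_sqr /= expr0 mul1r.
by rewrite expr1 opprK.
Qed.

Lemma majorana_theta X g :
  majorana g * theta a X = (-1) ^+ (val g.1 \in X) * (theta a X * majorana g).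
Proof.
rewrite theta_word (gam_word majorana_anticomm) count_subset_word -signr_odd.
by rewrite oddD size_sites_word oddb.
Qed.

Lemma theta_gword X w : {in w, forall g, val g.1 \in X} ->
  theta a X * gword w = (-1) ^+ size w * (gword w * theta a X).
Proof.
elim: w => [|g w IHw] wX; first by rewrite /word big_nil expr0 !mul1r mulr1.
rewrite word_cons /= exprS mulN1r mulNr [LHS]mulrA.
have -> : theta a X * majorana g = - (majorana g * theta a X).
  by rewrite majorana_theta wX ?mem_head // expr1 mulN1r opprK.
rewrite mulNr -[X in - X = _]mulrA IHw => [|h hw]; last by rewrite wX // inE hw orbT.
by rewrite [X in - X]mulrA commr_sign !mulrA.
Qed.

(** * Local algebras and the parity automorphism *)

Lemma local_alg_majorana X g : val g.1 \in X -> local_alg a X (majorana g).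
Proof.
move=> gX; rewrite majoranaE addrC.
have gen z : z = a g.1 \/ z = star (a g.1) -> local_alg a X z.
  by move=> zE; apply: gen_subalg_gen; exists g.1.
rewrite -[(-1) ^+ _ * _]scale1r; apply: gen_subalg_linear; last by apply: gen; right.
by apply: gen_subalg_sign; apply: gen; left.
Qed.

Lemma local_alg_gword X w :
  {in w, forall g, val g.1 \in X} -> local_alg a X (gword w).
Proof.
elim: w => [_|g w IHw wX]; first by rewrite /word big_nil; exact: gen_subalg1.
rewrite word_cons; apply: gen_subalgM.
  by apply: local_alg_majorana; rewrite wX ?mem_head.
by apply: IHw => h hw; rewrite wX // inE hw orbT.
Qed.

(** Half the difference and half the sum of the two Majorana operators at a site recover a and a^*,
    so they can serve as generators. *)
Lemma local_alg_ind X (S : set A) :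
  S 1 -> (forall (c : R[i]) (y z : A), S y -> S z -> S (c *: y + z)) ->
  (forall y z : A, S y -> S z -> S (y * z)) ->
  (forall g, val g.1 \in X -> S (majorana g)) -> local_alg a X `<=` S.
Proof.
move=> S1 SD SM SX; have SZ (c : R[i]) z : S z -> S (c *: z).
  move=> Sz; rewrite -[c *: z]addr0 -(addNr 1) -(scaleN1r 1).
  by apply: (SD) => //; exact: SD.
apply: gen_subalg_ind => // z [x xX zE].
have Sx := SX (x, false) xX; have {}SX := SX (x, true) xX.
have half z' : z' = (2 : R[i])^-1 *: (z' *+ 2).
  have -> : z' *+ 2 = (2 : R[i]) *: z' by rewrite scaler_nat.
  by rewrite scalerA mulVf ?scale1r // pnatr_eq0.
have aE : a x = (2 : R[i])^-1 *: (majorana (x, false) - majorana (x, true)).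
  by rewrite [LHS]half /majorana /= opprB [in RHS]addrC [in RHS]addrA subrK mulr2n.
have sE : star (a x) = (2 : R[i])^-1 *: (majorana (x, false) + majorana (x, true)).
  by rewrite [LHS]half /majorana /= addrACA subrr addr0 mulr2n.
case: zE => ->; rewrite ?sE ?aE; apply: SZ.
  by rewrite addrC -scaleN1r; exact: SD.
by rewrite -[majorana (x, false)]scale1r; exact: SD.
Qed.

Lemma local_algW X z : local_alg a X z -> local_alg a L z.
Proof.
apply: local_alg_ind z => [|c y z|y z|g _]; first exact: gen_subalg1.
- exact: gen_subalg_linear.
- exact: gen_subalgM.
- by apply: local_alg_majorana; exact: valP.
Qed.

Lemma theta_conj_linear X (c : R[i]) (y z : A) :
  theta a X * (c *: y + z) * theta a X =
  c *: (theta a X * y * theta a X) + theta a X * z * theta a X.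
Proof. by rewrite mulrDr mulrDl -scalerAr -scalerAl. Qed.

Lemma theta_conjM X (y z : A) :
  theta a X * (y * z) * theta a X =
  (theta a X * y * theta a X) * (theta a X * z * theta a X).
Proof. by rewrite !mulrA -(mulrA _ (theta a X) (theta a X)) theta_sqr mulr1. Qed.

Lemma theta_conj_majorana X g :
  theta a X * majorana g * theta a X = (-1) ^+ (val g.1 \in X) * majorana g.
Proof.
rewrite -mulrA majorana_theta mulrA commr_sign -mulrA; congr (_ * _).
by rewrite mulrA theta_sqr mul1r.
Qed.

Lemma theta_conj_gword X w : {in w, forall g, val g.1 \in X} ->
  theta a X * gword w * theta a X = (-1) ^+ size w * gword w.
Proof. by move=> wX; rewrite theta_gword // -!mulrA theta_sqr mulr1. Qed.

(** Both conjugations are multiplicative and linear, and both negate every generator in [X]. *)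
Lemma theta_conj_local X z : local_alg a X z ->
  theta a L * z * theta a L = theta a X * z * theta a X.
Proof.
apply: (local_alg_ind
  (S := [set z | theta a L * z * theta a L = theta a X * z * theta a X])).
- by rewrite /= !mulr1 !theta_sqr.
- by move=> c y t /= yE tE; rewrite !theta_conj_linear yE tE.
- by move=> y t /= yE tE; rewrite !theta_conjM yE tE.
- by move=> g gX /=; rewrite !theta_conj_majorana gX (valP g.1).
Qed.

(* Twisted locality: [z] localized in [X] can be moved past a generator
   outside [X] at the cost of the parity automorphism. *)
Lemma majorana_local X g z : val g.1 \notin X -> local_alg a X z ->
  majorana g * z = theta a X * z * theta a X * majorana g.
Proof.
move=> gX; apply: (local_alg_ind
  (S := [set z | majorana g * z = theta a X * z * theta a X * majorana g])).
- by rewrite /= !mulr1 theta_sqr mul1r.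
- move=> c y t /= yE tE.
  by rewrite theta_conj_linear mulrDr -scalerAr yE tE mulrDl -scalerAl.
- by move=> y t /= yE tE; rewrite theta_conjM mulrA yE -mulrA tE !mulrA.
- move=> h hX /=; rewrite theta_conj_majorana hX expr1 mulN1r mulNr.
  by apply: majorana_anticomm; apply: contraNneq gX => ->.
Qed.

(** [S] need not be closed under products, so the induction runs on the intersection [span] of all
    linear sets containing the words; fixing one factor at a time shows that [span] is
    multiplicative. *)
Lemma gword_span (S : set A) :
  (forall (c : R[i]) (y z : A), S y -> S z -> S (c *: y + z)) ->
  (forall w, S (gword w)) -> S = setT.
Proof.
move=> SD Sw; apply/seteqP; split=> // z _.
pose lin (S' : set A) := forall (c : R[i]) (y z : A), S' y -> S' z -> S' (c *: y + z).
pose span := [set z | forall S' : set A, lin S' -> (forall w, S' (gword w)) -> S' z].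
suff: span z by apply.
have: local_alg a L z by rewrite (car_gen hA).
apply: local_alg_ind => {z S SD Sw}.
- by move=> S _ /(_ [::]); rewrite /word big_nil; exact.
- by move=> c y z /= Sy Sz S SD Sw; apply: (SD); [exact: Sy | exact: Sz].
- move=> y z /= Sy Sz S SD Sw.
  apply: (Sy [set y | S (y * z)]) => [c u v /= Su Sv|w /=].
    by rewrite mulrDl -scalerAl; exact: SD.
  apply: (Sz [set z | S (gword w * z)]) => [c u v /= Su Sv|v /=].
    by rewrite mulrDr -scalerAr; exact: SD.
  by rewrite -word_cat.
- by move=> g _ S _ /(_ [:: g]); rewrite /word big_seq1; exact.
Qed.

(** * The conditional expectation *)

Section ConditionalExpectation.
Variables (X : {fset Gamma}) (s : seq (L `\` X)%fset).
Hypothesis s_uniq : uniq s.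
Hypothesis s_full : forall y : (L `\` X)%fset, y \in s.
Local Notation Y := (L `\` X)%fset.
Local Notation E := (cond_exp a s).
Implicit Types (alpha : {ffun Y -> 'I_4}) (k : Y * bool).

(** * Outer letters and the operators u(alpha) *)

Definition outer k : L * bool := (fincl (fsubsetDl L X) k.1, k.2).

Lemma outerP g : reflect (exists k, g = outer k) (val g.1 \notin X).
Proof.
apply: (iffP idP) => [gX|[[y b] ->] /=]; last by have := valP y; rewrite inE => /andP[].
have gY : val g.1 \in Y by rewrite inE gX (valP g.1).
by exists ([` gY]%fset, g.2); case: g gX gY => x b ? ?; congr (_, _); apply: val_inj.
Qed.

Lemma outer_inj : injective outer.
Proof.
move=> [x b] [y c] [xy ->]; congr (_, _).
by apply: val_inj; rewrite /= xy.
Qed.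

Local Notation gamY := (majorana \o outer).

Lemma outer_anticomm k l : k != l -> gamY k * gamY l = - (gamY l * gamY k).
Proof. by move=> kl; apply: majorana_anticomm; rewrite (inj_eq outer_inj). Qed.

Lemma outer_sqr_sign k : eq_sign (gamY k * gamY k) 1.
Proof. exact: majorana_sqr_sign. Qed.

(* [u^(j)] is the product of the majoranas of the site selected by the binary
   digits of [j]. *)
Definition digit (j : 'I_4) (b : bool) : bool := if b then (1 < j)%N else odd j.

(** Adding 2 modulo 4 toggles the high digit; exchanging 2m and 2m+1 toggles the low one. *)
Definition flip_digit (b : bool) (j : 'I_4) : 'I_4 :=
  inord (if b then (j + 2) %% 4 else if odd j then j.-1 else j.+1)%N.

Lemma digit_flip b c j : digit (flip_digit b j) c = digit j c (+) (c == b).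
Proof.
by case: j b c => [[|[|[|[|//]]]]] jP [] []; rewrite /digit /flip_digit /= inordK.
Qed.

Lemma flip_digitK b : involutive (flip_digit b).
Proof.
by move=> [[|[|[|[|//]]]] jP]; apply: val_inj; case: b;
  rewrite /flip_digit /= ?[X in inord (X %% _)]inordK ?inordK.
Qed.

Lemma u_site_word (y : Y) j :
  u_site a (fincl (fsubsetDl L X) y) j =
  word gamY [seq k <- [:: (y, false); (y, true)] | digit j k.2].
Proof.
case: j => [[|[|[|[|//]]]]] jP; rewrite /u_site /word /digit /=.
- by rewrite big_nil.
- by rewrite big_seq1 /= /majorana.
- by rewrite big_seq1 /= /majorana.
- by rewrite big_cons big_seq1 /= parity_site.
Qed.

Definition outer_sites := [seq (t, b) | t <- s, b <- [:: false; true]].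

Lemma u_prod_word alpha :
  u_prod a s alpha = word gamY [seq k <- outer_sites | digit (alpha k.1) k.2].
Proof.
rewrite /u_prod /outer_sites; elim: s => [|t r IHr].
  by rewrite big_nil /word big_nil.
by rewrite big_cons IHr u_site_word -word_cat /=; congr word; do 2!case: ifP => _.
Qed.

Definition flip k alpha : {ffun Y -> 'I_4} :=
  [ffun t => if t == k.1 then flip_digit k.2 (alpha t) else alpha t].

Lemma flipK k : involutive (flip k).
Proof.
move=> alpha; apply/ffunP => t; rewrite !ffunE.
by case: eqP => // _; rewrite flip_digitK.
Qed.

(** u(alpha) is a square-free word in a list containing every outer letter exactly once, so the
    multiplication toggles the letter [k], that is, one digit of [alpha]. *)
Lemma outer_u_prod k alpha :
  eq_sign (gamY k * u_prod a s alpha) (u_prod a s (flip k alpha)).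
Proof.
rewrite !u_prod_word.
apply: eq_sign_trans (word_gam_filter outer_anticomm outer_sqr_sign _ _ _) _.
- apply: allpairs_uniq => //; by case=> ? ? [].
- by apply/allpairsP; exists k; split=> //; case: k => ? [].
rewrite (eq_filter (a2 := fun l => digit (flip k alpha l.1) l.2)).
  exact: eq_sign_refl.
case: k => y b [z c]; rewrite ffunE xpair_eqE /=.
by case: eqP => // _; rewrite ?digit_flip ?addbF.
Qed.

Lemma u_prod_outer k alpha :
  eq_sign (u_prod a s alpha * gamY k) (u_prod a s (flip k alpha)).
Proof.
apply: eq_sign_trans (outer_u_prod k alpha); apply: eq_sign_sym.
rewrite u_prod_word; exact: gam_word_sign outer_anticomm _ _.
Qed.

Lemma eq_sign_conj (u v z : A) : eq_sign u v -> star u * z * u = star v * z * v.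
Proof.
case=> -[] ->; rewrite ?expr0 ?mul1r // expr1 mulN1r starN.
by rewrite !mulNr mulrN opprK.
Qed.

(** * Invariance, idempotence and norm *)

Lemma cond_exp_linear (c : R[i]) (y z : A) : E (c *: y + z) = c *: E y + E z.
Proof.
rewrite /cond_exp scalerA [c * _]mulrC -scalerA -scalerDr; congr (_ *: _).
rewrite scaler_sumr -big_split /=; apply: eq_bigr => alpha _.
by rewrite mulrDr mulrDl -scalerAr -scalerAl.
Qed.

(** Conjugation by an outer letter permutes the summands through the involution [flip k]; the signs
    occur twice in each summand and cancel. *)
Lemma cond_exp_conjr k z : star (gamY k) * E z * gamY k = E z.
Proof.
rewrite /cond_exp -scalerAr -scalerAl; congr (_ *: _).
rewrite mulr_sumr mulr_suml (reindex_inj (inv_inj (flipK k))) /=.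
apply: eq_bigr => alpha _.
have := eq_sign_conj z (u_prod_outer k (flip k alpha)).
by rewrite starM flipK !mulrA.
Qed.

Lemma cond_exp_conjl k z : E (star (gamY k) * z * gamY k) = E z.
Proof.
rewrite /cond_exp; congr (_ *: _).
rewrite (reindex_inj (inv_inj (flipK k))) /=; apply: eq_bigr => alpha _.
have := eq_sign_conj z (outer_u_prod k (flip k alpha)).
by rewrite starM flipK !mulrA.
Qed.

Lemma cond_exp_comm g z : val g.1 \notin X -> majorana g * E z = E z * majorana g.
Proof.
move=> /outerP[k ->]; rewrite -{1}(cond_exp_conjr k z) /= !mulrA majorana_unitaryr.
by rewrite mul1r.
Qed.

(** Conjugation by the unitary [majorana g] turns [z] into [- z] but does not change [E z]. *)
Lemma cond_exp_anticomm g z : val g.1 \notin X ->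
  majorana g * z = - (z * majorana g) -> E z = 0.
Proof.
move=> /outerP[k ->] gz; apply: eq_oppr0.
have EN (y : A) : E (- y) = - E y.
  have E0 : E 0 = 0.
    by rewrite /cond_exp big1 ?scaler0 // => alpha _; rewrite mulr0 mul0r.
  by have := cond_exp_linear (-1) y 0; rewrite E0 !scaleN1r !addr0.
rewrite -EN -{1}(cond_exp_conjl k z) /=; congr E.
rewrite -mulrA; have -> : z * majorana (outer k) = - (majorana (outer k) * z).
  by rewrite gz opprK.
by rewrite mulrN mulrA majorana_unitaryl mul1r.
Qed.

Lemma u_prod_unitary alpha : star (u_prod a s alpha) * u_prod a s alpha = 1.
Proof.
rewrite u_prod_word; elim: [seq _ <- _ | _] => [|k w IHw].
  by rewrite /word big_nil star1 mulr1.
rewrite word_cons starM -mulrA [star (gamY k) * _]mulrA majorana_unitaryl.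
by rewrite mul1r.
Qed.

Lemma card_index : #|{: {ffun Y -> 'I_4}}| = (4 ^ #|` Y|)%N.
Proof. by rewrite card_ffun card_ord -cardfE. Qed.

(** Such a [z] commutes with every unitary u(alpha), so each of the 4^n summands equals [z]. *)
Lemma cond_exp_id z :
  (forall g, val g.1 \notin X -> majorana g * z = z * majorana g) -> E z = z.
Proof.
move=> zC; rewrite /cond_exp (eq_bigr (fun=> z)) => [|alpha _].
  rewrite sumr_const card_index -[z *+ _](scaler_nat (R := R[i])) scalerA.
  by rewrite natrX mulVf ?scale1r.
rewrite -mulrA; have <- : u_prod a s alpha * z = z * u_prod a s alpha.
  rewrite u_prod_word; apply/commr_sym/commr_prod => k _.
  by apply: commr_sym; apply: zC; apply/outerP; exists k.
by rewrite mulrA u_prod_unitary mul1r.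
Qed.

Lemma cond_exp_idem : E \o E = E.
Proof. by apply/funext => z /=; apply: cond_exp_id => g; exact: cond_exp_comm. Qed.

Lemma cnorm_cond_exp z : cnorm (E z) <= cnorm z.
Proof.
rewrite /cond_exp cnormZ.
have sum_le : cnorm (\sum_alpha star (u_prod a s alpha) * z * u_prod a s alpha) <=
    (4 ^ #|` Y|)%N%:R * cnorm z.
  rewrite (le_trans (ler_cnorm_sum _ _ _)) // -card_index mulr_natl -sumr_const.
  apply: ler_sum => alpha _.
  rewrite (le_trans (ler_cnormM _ _)) // (cnorm_unitary (u_prod_unitary alpha)) mulr1.
  rewrite (le_trans (ler_cnormM _ _)) // cnorm_star.
  by rewrite (cnorm_unitary (u_prod_unitary alpha)) mul1r.
have -> : ((4 : R[i]) ^+ #|` Y|)^-1 = ((((4 ^ #|` Y|)%N%:R)^-1 : R)%:C)%C.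
  by rewrite fmorphV rmorph_nat natrX.
rewrite {1}/Normc.normc /= expr0n addr0 sqrtr_sqr ger0_norm ?invr_ge0 ?ler0n //.
by rewrite mulrC ler_pdivrMr ?ltr0n ?expn_gt0 // mulrC.
Qed.

Lemma opnorm_cond_exp : opnorm E = 1%E.
Proof.
have n1 : cnorm (1 : A) = 1 by apply: cnorm_unitary; rewrite star1 mulr1.
apply/eqP; rewrite eq_le; apply/andP; split.
  apply: ub_ereal_sup => _ [z /= z1 <-].
  by rewrite lee_fin (le_trans (cnorm_cond_exp z)).
apply: ereal_sup_ubound; exists 1; rewrite /= ?n1 //.
by rewrite cond_exp_id ?n1 // => g _; rewrite mulr1 mul1r.
Qed.

(** * The range *)

Lemma even_alg_linear (c : R[i]) (y z : A) :
  even_alg a X y -> even_alg a X z -> even_alg a X (c *: y + z).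
Proof.
move=> [yX yE] [zX zE]; split; first exact: gen_subalg_linear.
by rewrite theta_conj_linear yE zE.
Qed.

Lemma odd_alg_linear (c : R[i]) (y z : A) :
  odd_alg a X y -> odd_alg a X z -> odd_alg a X (c *: y + z).
Proof.
move=> [yX yE] [zX zE]; split; first exact: gen_subalg_linear.
by rewrite theta_conj_linear yE zE scalerN opprD.
Qed.

Lemma local_alg0 : local_alg a X 0.
Proof. by rewrite -(scale0r 1); apply: gen_subalgZ; exact: gen_subalg1. Qed.

Lemma even_alg0 : even_alg a X 0.
Proof. by split; [exact: local_alg0 | rewrite mulr0 mul0r]. Qed.

Lemma odd_alg0 : odd_alg a X 0.
Proof. by split; [exact: local_alg0 | rewrite mulr0 mul0r oppr0]. Qed.

Let D := [set z + w * theta a L | z in even_alg a X & w in odd_alg a X].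

Lemma range_alg_even z : even_alg a X z -> D z.
Proof. by exists z => //; exists 0; [exact: odd_alg0 | rewrite mul0r addr0]. Qed.

Lemma range_alg_odd z : odd_alg a X z -> D (z * theta a L).
Proof. by exists 0; [exact: even_alg0 | exists z; rewrite ?add0r]. Qed.

Lemma range_alg_linear (c : R[i]) (y z : A) : D y -> D z -> D (c *: y + z).
Proof.
move=> [y0 y0X [y1 y1X <-]] [z0 z0X [z1 z1X <-]].
exists (c *: y0 + z0); first exact: even_alg_linear.
exists (c *: y1 + z1); first exact: odd_alg_linear.
by rewrite scalerDr scalerAl mulrDl addrACA.
Qed.

Lemma range_alg_sign (y z : A) : eq_sign y z -> D z -> D y.
Proof.
have D0 := range_alg_even even_alg0.
case=> -[] -> Dz; rewrite ?expr0 ?mul1r // expr1 mulN1r -scaleN1r -[_ *: z]addr0.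
exact: range_alg_linear.
Qed.

(** Passing an outer letter through the odd factor gives one sign and through [theta a L] another;
    the two cancel. *)
Lemma range_alg_comm g z : val g.1 \notin X -> D z ->
  majorana g * z = z * majorana g.
Proof.
move=> gX [z0 [z0X z0E] [z1 [z1X z1E] <-]].
rewrite mulrDr mulrDl mulrA !(majorana_local gX) // z0E z1E; congr (_ + _).
rewrite !mulNr -[X in - X]mulrA majorana_theta (valP g.1) expr1 mulN1r mulrN opprK.
by rewrite mulrA.
Qed.

(** [w] may contain outer letters, so parity is read off with [theta a L] and carried over to
    [theta a X] by locality of [v]. *)
Lemma even_gword w v : {in v, forall g, val g.1 \in X} -> ~~ odd (size w) ->
  eq_sign (gword v) (gword w) -> even_alg a X (gword v).
Proof.
move=> vX w_even [e vE]; split; first exact: local_alg_gword.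
rewrite -theta_conj_local; last exact: local_alg_gword.
rewrite vE mulrA commr_sign -!mulrA; congr (_ * _); rewrite mulrA.
rewrite theta_conj_gword => [|g _]; last exact: valP.
by rewrite -signr_odd (negbTE w_even) mul1r.
Qed.

Lemma mem_subset_word g : (g \in subset_word X) = (val g.1 \in X).
Proof. by rewrite -has_pred1 has_count count_subset_word lt0b. Qed.

Lemma odd_gword w v : {in v, forall g, val g.1 \in X} -> odd (size w) ->
  eq_sign (gword w) (gword v * theta a L) -> odd_alg a X (gword v).
Proof.
move=> vX w_odd [e wE]; split; first exact: local_alg_gword.
rewrite -theta_conj_local; last exact: local_alg_gword.
have w_conj : theta a L * gword w * theta a L = - gword w.
  rewrite theta_conj_gword => [|g _]; last exact: valP.
  by rewrite -signr_odd w_odd expr1 mulN1r.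
have -> : gword v = (-1) ^+ e * (gword w * theta a L).
  by rewrite wE -!mulrA theta_sqr mulr1 signrMK.
rewrite mulrA commr_sign -!mulrA -mulrN; congr (_ * _).
by rewrite !mulrA w_conj mulNr.
Qed.

Lemma cond_exp_gword w : D (E (gword w)).
Proof.
(* Odd [size w + count_mem g w] means that the outer letter [g] anticommutes with the word, which
   [E] then annihilates. *)
have [/existsP[g /andP[gX odd_g]]|/existsPn/= all_even] :=
    boolP [exists g, (val g.1 \notin X) && odd (size w + count_mem g w)].
  rewrite (cond_exp_anticomm gX); first exact: range_alg_even even_alg0.
  by rewrite (gam_word majorana_anticomm) -signr_odd odd_g expr1 mulN1r.
have outer_count g : val g.1 \notin X -> odd (count_mem g w) = odd (size w).
  move=> gX; have := all_even g; rewrite gX /= oddD.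
  by case: odd; case: odd.
rewrite cond_exp_id => [|g gX]; last first.
  rewrite (gam_word majorana_anticomm) -signr_odd oddD outer_count // addbb.
  by rewrite expr0 mul1r.
set v := [seq g <- w | val g.1 \in X].
have vX : {in v, forall g, val g.1 \in X} by move=> g; rewrite mem_filter => /andP[].
have count_v g : count_mem g v = ((val g.1 \in X) * count_mem g w)%N.
  rewrite count_filter; case: (boolP (val g.1 \in X)) => gX.
    by rewrite mul1n; apply: eq_count => h /=; case: eqP => // ->; rewrite gX.
  rewrite mul0n -(count_pred0 w); apply: eq_count => h /=.
  by case: eqP => // ->; rewrite (negbTE gX).
have eqs := eq_sign_word majorana_anticomm majorana_sqr_sign.
have [w_odd|w_even] := boolP (odd (size w)).
  (* Multiplying by [theta a L] adds one to every multiplicity; the appended [subset_word X] undoes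
     this modulo 2 for the letters of [X], while each outer letter stays odd. *)
  set v' := v ++ subset_word X.
  have v'X : {in v', forall g, val g.1 \in X}.
    by move=> g; rewrite mem_cat mem_subset_word => /orP[/vX|].
  have wv' : eq_sign (gword w) (gword v' * theta a L).
    rewrite theta_word -word_cat; apply: eqs => g.
    rewrite !count_cat count_v !count_subset_word (valP g.1) !oddD.
    have := outer_count g; case: (val g.1 \in X) => [_|->] //=.
      by rewrite mul1n addbK.
  by apply: range_alg_sign (wv') _; apply: range_alg_odd; exact: odd_gword wv'.
have wv : eq_sign (gword w) (gword v).
  apply: eqs => g; rewrite count_v; have := outer_count g.
  by case: (val g.1 \in X) => [_|->] //; rewrite ?mul1n // mul0n (negbTE w_even).
apply: range_alg_sign (wv) _; apply: range_alg_even.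
exact: even_gword vX w_even (eq_sign_sym wv).
Qed.

Lemma cond_exp_range : E @` setT = D.
Proof.
apply/seteqP; split=> [_ [z _ <-]|z Dz].
  have DE : [set y | D (E y)] = setT.
    apply: gword_span => [c y t /= Dy Dt|w /=]; last exact: cond_exp_gword.
    by rewrite cond_exp_linear; exact: range_alg_linear.
  by rewrite -[D _]/([set y | D (E y)] z) DE.
by exists z => //; apply: cond_exp_id => g gX; exact: range_alg_comm.
Qed.

(** * Compatibility with parity *)

Lemma star_theta : star (theta a L) = theta a L.
Proof.
have unitary w : star (gword w) * gword w = 1.
  elim: w => [|g w IHw]; first by rewrite /word big_nil star1 mulr1.
  rewrite word_cons starM -mulrA [star (majorana g) * _]mulrA majorana_unitaryl.
  by rewrite mul1r.
by rewrite -[LHS]mulr1 -(theta_sqr L) mulrA {2}theta_word theta_word unitary mul1r.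
Qed.

Lemma u_prod_theta alpha :
  eq_sign (u_prod a s alpha * theta a L) (theta a L * u_prod a s alpha).
Proof.
rewrite u_prod_word; set w := [seq _ <- _ | _].
have -> : word gamY w = gword (map outer w) by rewrite /word big_map.
rewrite theta_gword => [|g _]; last exact: valP.
by rewrite -signr_odd; apply: eq_sign_sym; eexists.
Qed.

(** [theta a L] commutes up to sign with each u(alpha), and conjugation does not see the sign. *)
Lemma cond_exp_theta_conj z :
  theta a L * E z * theta a L = E (theta a L * z * theta a L).
Proof.
rewrite /cond_exp -scalerAr -scalerAl; congr (_ *: _).
rewrite mulr_sumr mulr_suml; apply: eq_bigr => alpha _.
have := eq_sign_conj z (u_prod_theta alpha).
by rewrite !starM star_theta !mulrA.
Qed.

Lemma cond_exp_even : E @` even_alg a L = even_alg a X.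
Proof.
apply/seteqP; split=> [_ [z [_ zE] <-]|z [zX zE]].
  have : D (E z) by rewrite -cond_exp_range; exists z.
  case=> y yX [w wX Ez]; have [wloc wE] := wX.
  (* [E z] is fixed by the parity automorphism, which fixes [y] and negates [w * theta a L]; hence
     the latter equals its own negative. *)
  suff w0 : w * theta a L = 0 by rewrite -Ez w0 addr0.
  have := cond_exp_theta_conj z; rewrite zE -Ez mulrDr mulrDl.
  have [yloc yE] := yX; rewrite (theta_conj_local yloc) yE => /addrI wN.
  by apply: eq_oppr0; rewrite -[LHS]wN mulrA (theta_conj_local wloc) wE mulNr.
exists z; last first.
  by apply: cond_exp_id => g gX; apply: range_alg_comm (range_alg_even _).
by split; [exact: local_algW zX | rewrite (theta_conj_local zX)].
Qed.

End ConditionalExpectation.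
End CAR.

Unset Implicit Arguments.

Theorem lemma4p1 (R : realType) (Gamma : countType) (L X : {fset Gamma})
    (hXL : (X `<=` L)%fset)
    (A : cstarAlgType R) (a : L -> A) (hA : is_CAR_algebra a)
    (s : seq (L `\` X)%fset)
    (hs : uniq s /\ forall x : (L `\` X)%fset, x \in s) :
  [/\ opnorm (cond_exp a s) = 1%E,
      cond_exp a s \o cond_exp a s = cond_exp a s,
      cond_exp a s @` setT =
        [set z + w * theta a L | z in even_alg a X & w in odd_alg a X]
    & cond_exp a s @` even_alg a L = even_alg a X].
Proof.
case: hs => s_uniq s_full; split.
- exact: opnorm_cond_exp.
- exact: cond_exp_idem.
- exact: cond_exp_range.
- exact: cond_exp_even.
Qed.
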